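(* For every integer $n\ge 1$, \[\overline{p}(3n)\equiv (-1)^n\, r_5(n) \pmod 9.\]
   Context: An overpartition of a nonnegative integer $n$ is a partition of $n$ in which the first occurrence of each distinct part may (or may not) be overlined; $\overline{p}(n)$ denotes the number of overpartitions of $n$ (with $\overline{p}(0)=1$). Equivalently, $\sum_{n\ge0}\overline{p}(n)q^n=\prod_{k\ge1}\frac{1+q^k}{1-q^k}=1/\varphi(-q)$, where $\varphi(q)=\sum_{n=-\infty}^{\infty}q^{n^2}$. For an integer $k\ge1$, $r_k(n)$ denotes the number of $(x_1,\dots,x_k)\in\mathbb{Z}^k$ with $x_1^2+\cdots+x_k^2=n$. *)

(* Defs.v *)
From mathcomp Require Import all_boot all_order all_algebra.
Set Implicit Arguments. Unset Strict Implicit. Unset Printing Implicit Defensive.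
Import GRing.Theory Num.Theory.

(* Overpartitions of n in multiplicity form.  A partition of n is determined by
   the multiplicity m k of each part size k (1 <= k <= n, and m k <= n), with
   \sum_k k * m k = n.  An overpartition additionally marks (overlines) the first
   occurrence of some of the distinct parts: a flag o k that may be true only if
   part k actually occurs (m k > 0).  Index i : 'I_n stands for part size i+1. *)
Definition is_overpartition (n : nat)
    (m : {ffun 'I_n -> 'I_n.+1}) (o : {ffun 'I_n -> bool}) : bool :=
  ((\sum_(i < n) i.+1 * m i)%N == n) && [forall i, o i ==> (0 < m i)%N].

Definition overpartition_count (n : nat) : nat :=
  #|[set mo : {ffun 'I_n -> 'I_n.+1} * {ffun 'I_n -> bool}
     | is_overpartition mo.1 mo.2]|.

(* r_k(n): number of (x_1,...,x_k) in Z^k with x_1^2+...+x_k^2 = n.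
   Every such x has |x_i| <= n, so we enumerate x_i = j - n with j in [0, 2n]. *)
Definition r_sq (k n : nat) : nat :=
  #|[set x : {ffun 'I_k -> 'I_(2 * n + 1)} |
      (\sum_(i < k) ((x i)%:Z - n%:Z) ^+ 2 == n%:Z)%R]|.

(* Main.v *)
Require Import Defs.
From Corelib Require Import Setoid Morphisms.
From mathcomp Require Import all_boot all_order all_algebra.
From mathcomp Require Import ring zify.
Set Implicit Arguments.
Unset Strict Implicit.
Unset Printing Implicit Defensive.
Import GRing.Theory.
Local Open Scope ring_scope.

(** Put [t(q) = sum_s (-1)^s q^(s^2)], summed over all integers. By Gauss,
    [t(q) = prod_k (1 - q^k)/(1 + q^k)], so [1/t(q)] is the generating series
    of overpartitions. A square is divisible by 9 or congruent to 1 modulo 3,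
    hence [t(q) = a(q^3) + q b(q^3)] with [a(q) = t(q^3)]. The norm of [t] over
    the series in [q^3] is [N(q^3)], where [N(q) = a^3 + q b^3], and
    rationalizing the denominator of [1/t(q)] gives [sum_n p(3n) q^n = a^2/N].
    The norm is multiplicative, so Gauss's product yields
    [N = t(q)^4/t(q^3)]. Therefore [sum_n p(3n) q^n = t(q^3)^3/t(q)^4], and
    [t(q^3)^3 = t(q)^9] modulo 9, which leaves [t(q)^5]. Series are handled as
    polynomials modulo a power of [X]. *)

Definition eqmodX (R : nzSemiRingType) (N : nat) (p q : {poly R}) : Prop :=
  forall i, (i < N)%N -> p`_i = q`_i.

Notation "p = q %[ 'modX' N ]" := (eqmodX N p q)
  (at level 70, q at next level, format "p  =  q  %[ 'modX'  N ]") : ring_scope.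

Section Congruence.
Variable R : comNzRingType.
Implicit Types (p q u : {poly R}) (M N d k : nat).

#[export] Instance eqmodX_equivalence N : Equivalence (@eqmodX R N).
Proof. by split=> [p|p q pq i /pq|p q r pq qr i iN] //; rewrite pq // qr. Qed.

#[export] Instance eqmodX_add N :
  Proper (@eqmodX R N ==> @eqmodX R N ==> @eqmodX R N) +%R.
Proof. by move=> p p' pp q q' qq i iN; rewrite !coefD pp // qq. Qed.

#[export] Instance eqmodX_opp N : Proper (@eqmodX R N ==> @eqmodX R N) -%R.
Proof. by move=> p p' pp i iN; rewrite !coefN pp. Qed.

#[export] Instance eqmodX_mul N :
  Proper (@eqmodX R N ==> @eqmodX R N ==> @eqmodX R N) *%R.
Proof.
move=> p p' pp q q' qq i iN; rewrite !coefM; apply: eq_bigr => j _.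
by rewrite pp ?qq //; have := ltn_ord j; lia.
Qed.

#[export] Instance eqmodX_exp N :
  Proper (@eqmodX R N ==> eq ==> @eqmodX R N) (@GRing.exp _).
Proof. by move=> p p' pp k _ <-; elim: k => // k IH; rewrite !exprS IH pp. Qed.

Lemma eqmodX_leq M N p q :
  (M <= N)%N -> p = q %[modX N] -> p = q %[modX M].
Proof. by move=> MN pq i iM; apply: pq; apply: leq_trans MN. Qed.

Lemma eqmodX_prod N (I : Type) (r : seq I) (P : pred I) (F G : I -> {poly R}) :
  (forall i, P i -> F i = G i %[modX N]) ->
  \prod_(i <- r | P i) F i = \prod_(i <- r | P i) G i %[modX N].
Proof.
move=> FG; apply: (big_ind2 (fun p q => p = q %[modX N])) => //.
by move=> p p' q q' -> ->.
Qed.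

Lemma eqmodX_addMXn N k p q : (N <= k)%N -> p + q * 'X^k = p %[modX N].
Proof. by move=> Nk i iN; rewrite coefD coefMXn (leq_trans iN Nk) addr0. Qed.

Lemma eqmodX_mulX N p q : p = q %[modX N] -> 'X * p = 'X * q %[modX N.+1].
Proof. by move=> pq [|i] iN; rewrite !coefXM //=; apply: pq. Qed.

Lemma eqmodX_lreg N u p q :
  GRing.lreg u`_0 -> u * p = u * q %[modX N] -> p = q %[modX N].
Proof.
move=> u0 upq; elim/ltn_ind => i IH iN; have := upq i iN.
rewrite !coefM !big_ord_recl /= subn0.
under eq_bigr => j _.
  rewrite IH; first over; rewrite /bump; have := ltn_ord j; lia.
by move/addIr/u0.
Qed.

Lemma eqmodX_comp_polyXn d N p q : (0 < d)%N ->
  p = q %[modX N] -> p \Po 'X^d = q \Po 'X^d %[modX d * N].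
Proof.
move=> d0 pq i iN; rewrite !coef_comp_poly_Xn //; case: ifP => // _.
by apply: pq; rewrite ltn_divLR // mulnC.
Qed.

End Congruence.

Lemma coef0_exp (R : nzSemiRingType) (p : {poly R}) (k : nat) :
  (p ^+ k)`_0 = p`_0 ^+ k.
Proof. exact: (rmorphXn (coefp 0)). Qed.

Lemma comp_monomialXn (R : comNzRingType) (d k : nat) (x : R) :
  (x *: 'X^k) \Po 'X^d = x *: 'X^(d * k).
Proof. by rewrite comp_polyZ comp_Xn_poly exprM. Qed.

Lemma comp_signed_monomialXn (R : comNzRingType) (d k m : nat) :
  ((-1) ^+ m * 'X^k) \Po 'X^d = (-1) ^+ m * 'X^(d * k) :> {poly R}.
Proof. by rewrite comp_polyM rmorph_sign comp_Xn_poly exprM. Qed.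

Definition multisect (R : nzSemiRingType) (d r : nat) (p : {poly R}) :
  {poly R} := \poly_(j < size p) p`_(d * j + r).

Section Multisection.
Variables (R : comNzRingType) (d : nat).
Hypothesis d_gt0 : (0 < d)%N.
Implicit Types (p q : {poly R}) (r s : nat).

Lemma coef_multisect r p j : (multisect d r p)`_j = p`_(d * j + r).
Proof.
rewrite coef_poly; case: ltnP => // pj; rewrite nth_default //.
by apply: leq_trans pj (leq_trans _ (leq_addr _ _)); rewrite leq_pmull.
Qed.

Lemma multisectD r p q :
  multisect d r (p + q) = multisect d r p + multisect d r q.
Proof. by apply/polyP => j; rewrite coefD !coef_multisect coefD. Qed.

Lemma multisectXn r s : (r < d)%N -> (s < d)%N ->
  multisect d r 'X^s = (r == s)%:R :> {poly R}.
Proof.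
move=> rd sd; apply/polyP => j; rewrite coef_multisect coefXn coefMn coef1.
case: j => [|j]; first by rewrite muln0.
by rewrite gtn_eqF ?mul0rn //; lia.
Qed.

Lemma multisectM_comp_polyXn r p q : (r < d)%N ->
  multisect d r (p * (q \Po 'X^d)) = multisect d r p * q.
Proof.
move=> rd; elim/poly_ind: q => [|q c IH].
  by apply/polyP => j; rewrite comp_poly0 !mulr0 coef_multisect !coef0.
rewrite comp_polyD comp_polyM comp_polyX comp_polyC !mulrDr multisectD.
congr (_ + _); last by apply/polyP => j; rewrite coefMC !coef_multisect coefMC.
apply/polyP => j; rewrite !mulrA -IH coefMX !coef_multisect coefMXn.
case: j => [|j] /=; first by rewrite muln0 rd.
by rewrite mulnS ltnNge -addnA leq_addr /= addKn.
Qed.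

Lemma multisectE p : p = \sum_(r < d) (multisect d r p \Po 'X^d) * 'X^r.
Proof.
apply/polyP => i; rewrite coef_sum.
under eq_bigr => r _ do rewrite coefMXn coef_comp_poly_Xn // coef_multisect.
rewrite (bigD1 (Ordinal (ltn_pmod i d_gt0))) //= ltnNge leq_mod /=.
have -> : (i - i %% d = i %/ d * d)%N by rewrite {1}(divn_eq i d) addnK.
rewrite dvdn_mull // mulnK // mulnC -divn_eq.
rewrite big1 ?addr0 // => r /eqP ri; case: ltnP => // le_ri.
case: ifP => // /dvdnP[k ik]; case: ri; apply: val_inj => /=.
by rewrite -(subnK le_ri) ik modnMDl modn_small.
Qed.

(* The bound on [n] is [d * (n - 1) + r < N], free of truncated subtraction. *)
Lemma eqmodX_multisect n N r p q : (d * n + r < N + d)%N ->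
  p = q %[modX N] -> multisect d r p = multisect d r q %[modX n].
Proof.
move=> nN pq j jn; rewrite !coef_multisect; apply: pq.
have : (d * j.+1 <= d * n)%N by rewrite leq_mul2l jn orbT.
by rewrite mulnS; lia.
Qed.

End Multisection.

Section CubicNorm.
Variable R : comNzRingType.
Implicit Types (p q a b c : {poly R}) (x : R) (k n : nat).

Definition trisect a b c : {poly R} :=
  (a \Po 'X^3) + (b \Po 'X^3) * 'X + (c \Po 'X^3) * 'X^2.

Lemma comp_polyX3_trisect a : a \Po 'X^3 = trisect a 0 0.
Proof. by rewrite /trisect !comp_poly0 !mul0r !addr0. Qed.

Lemma multisect_trisect a b c :
  [/\ multisect 3 0 (trisect a b c) = a, multisect 3 1 (trisect a b c) = b
    & multisect 3 2 (trisect a b c) = c].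
Proof.
have sectX r s p : (r < 3)%N -> (s < 3)%N ->
    multisect 3 r ((p \Po 'X^3) * 'X^s) = (r == s)%:R * p.
  by move=> r3 s3; rewrite mulrC multisectM_comp_polyXn // multisectXn.
have -> : trisect a b c =
    (a \Po 'X^3) * 'X^0 + (b \Po 'X^3) * 'X^1 + (c \Po 'X^3) * 'X^2.
  by rewrite expr0 mulr1.
by split; rewrite !multisectD // !sectX //=; ring.
Qed.

Lemma trisect_multisect p :
  trisect (multisect 3 0 p) (multisect 3 1 p) (multisect 3 2 p) = p.
Proof.
by rewrite [RHS](@multisectE _ 3) // !big_ord_recr big_ord0 /= add0r mulr1.
Qed.

Lemma trisectD a b c a' b' c' :
  trisect a b c + trisect a' b' c' = trisect (a + a') (b + b') (c + c').
Proof. by rewrite /trisect !comp_polyD; ring. Qed.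

Lemma trisectM a b c a' b' c' :
  trisect a b c * trisect a' b' c' =
  trisect (a * a' + 'X * (b * c' + c * b')) (a * b' + b * a' + 'X * (c * c'))
          (a * c' + b * b' + c * a').
Proof. by rewrite /trisect !(comp_polyD, comp_polyM) comp_polyX; ring. Qed.

(* If [w] is a primitive cube root of unity, then [cnorm p] evaluated at [X^3]
   is [p(X) p(wX) p(w^2 X)]. *)
Definition cnorm p : {poly R} :=
  let a := multisect 3 0 p in
  let b := multisect 3 1 p in
  let c := multisect 3 2 p in
  a ^+ 3 + 'X * b ^+ 3 + 'X^2 * c ^+ 3 - 3%:R * 'X * a * b * c.

Lemma cnorm_trisect a b c : cnorm (trisect a b c) =
  a ^+ 3 + 'X * b ^+ 3 + 'X^2 * c ^+ 3 - 3%:R * 'X * a * b * c.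
Proof. by rewrite /cnorm; have [-> -> ->] := multisect_trisect a b c. Qed.

Lemma cnorm1 : cnorm 1 = 1.
Proof.
rewrite -[X in cnorm X](comp_polyC 1 'X^3) comp_polyX3_trisect cnorm_trisect.
by ring.
Qed.

Lemma cnormM p q : cnorm (p * q) = cnorm p * cnorm q.
Proof.
rewrite -(trisect_multisect p) -(trisect_multisect q) trisectM !cnorm_trisect.
by ring.
Qed.

Lemma eqmodX_cnorm n p q :
  p = q %[modX 3 * n + 1] -> cnorm p = cnorm q %[modX n.+1].
Proof.
move=> pq; pose section r m := @eqmodX_multisect R 3 isT m _ r _ _ ^~ pq.
have sect0 : multisect 3 0 p = multisect 3 0 q %[modX n.+1].
  by apply: section; lia.
have sect1 : multisect 3 1 p = multisect 3 1 q %[modX n] by apply: section; lia.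
have sect2 : multisect 3 2 p = multisect 3 2 q %[modX n] by apply: section; lia.
have cnormE r : cnorm r = multisect 3 0 r ^+ 3 + 'X * (multisect 3 1 r ^+ 3 +
    'X * multisect 3 2 r ^+ 3 -
    3%:R * multisect 3 0 r * multisect 3 1 r * multisect 3 2 r).
  by rewrite /cnorm /=; ring.
rewrite !cnormE sect0; apply: eqmodX_add => //; apply: eqmodX_mulX.
by rewrite sect1 sect2.
Qed.

(* The second factor is the product of the images of the first one under
   [X -> wX] and [X -> w^2 X]. *)
Lemma trisect_mul_conjugates a b c :
  trisect a b c *
    trisect (a ^+ 2 - 'X * b * c) ('X * c ^+ 2 - a * b) (b ^+ 2 - a * c) =
  cnorm (trisect a b c) \Po 'X^3.
Proof.
by rewrite comp_polyX3_trisect trisectM cnorm_trisect; congr trisect; ring.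
Qed.

Lemma multisect_inverse_cnorm n p a b c :
  p * trisect a b c = 1 %[modX 3 * n + 1] ->
  multisect 3 0 p * cnorm (trisect a b c) = a ^+ 2 - 'X * b * c %[modX n.+1].
Proof.
move=> p_inv; rewrite -multisectM_comp_polyXn // -trisect_mul_conjugates mulrA.
set a' := a ^+ 2 - _; set b' := _ - a * b; set c' := _ - a * c.
have [a'E _ _] := multisect_trisect a' b' c'.
rewrite -[X in _ = X %[modX _]]a'E.
apply: (@eqmodX_multisect R 3 isT n.+1 (3 * n + 1)); first by lia.
by rewrite p_inv mul1r.
Qed.

Lemma cnorm_binomialX3 x k :
  cnorm (1 + x *: 'X^(3 * k)) = (1 + x *: 'X^k) ^+ 3.
Proof.
rewrite -comp_monomialXn -[X in X + _](comp_polyC 1 'X^3) -comp_polyD.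
by rewrite comp_polyX3_trisect cnorm_trisect; ring.
Qed.

Lemma cnorm_binomial x k :
  ~~ (3 %| k)%N -> cnorm (1 + x *: 'X^k) = 1 + x ^+ 3 *: 'X^k.
Proof.
move=> k_ndvd3; pose m := x *: 'X^(k %/ 3).
have splitX r : (m \Po 'X^3) * 'X^r = x *: 'X^(3 * (k %/ 3) + r).
  by rewrite comp_monomialXn -scalerAl -exprD.
have cubeX r : 'X^r * m ^+ 3 = x ^+ 3 *: 'X^(3 * (k %/ 3) + r).
  by rewrite exprZn -exprM -scalerAr -exprD addnC mulnC.
have kE r : (k %% 3 = r)%N -> k = (3 * (k %/ 3) + r)%N by lia.
have /orP[/eqP/kE k_mod1|/eqP/kE k_mod2] :
  (k %% 3 == 1)%N || (k %% 3 == 2)%N by lia.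
- have -> : 1 + x *: 'X^k = trisect 1 m 0.
    by rewrite {1}k_mod1 -splitX /trisect comp_polyC comp_poly0 mul0r addr0.
  by rewrite cnorm_trisect [in RHS]k_mod1 -cubeX; ring.
- have -> : 1 + x *: 'X^k = trisect 1 0 m.
    by rewrite {1}k_mod2 -splitX /trisect comp_polyC comp_poly0 mul0r addr0.
  by rewrite cnorm_trisect [in RHS]k_mod2 -cubeX; ring.
Qed.

End CubicNorm.

Section Theta.
Variable R : comNzRingType.
Implicit Types (x : R) (m n k s : nat).

(* In q-Pochhammer notation, [(- x q^(m+1); q)_(n-m)] for [m <= n]. *)
Definition qprod x m n : {poly R} := \prod_(m <= k < n) (1 + x *: 'X^(k.+1)).

Definition theta n : {poly R} :=
  1 + (\sum_(1 <= s < n.+1) (-1) ^+ s * 'X^(s ^ 2)) *+ 2.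

Lemma qprod_geq x m n : (n <= m)%N -> qprod x m n = 1.
Proof. exact: big_geq. Qed.

Lemma qprod_recl x m n :
  (m < n)%N -> qprod x m n = (1 + x *: 'X^(m.+1)) * qprod x m.+1 n.
Proof. exact: big_ltn. Qed.

Lemma qprod_recr x m n :
  (m <= n)%N -> qprod x m n.+1 = qprod x m n * (1 + x *: 'X^(n.+1)).
Proof. exact: big_nat_recr. Qed.

Lemma coef0_qprod x m n : (qprod x m n)`_0 = 1.
Proof.
rewrite coef0_prod big1 // => k _.
by rewrite coefD coef1 coefZ coefXn mulr0 addr0.
Qed.

Lemma eqmodX_qprod x m n :
  (m <= n)%N -> qprod x 0 n = qprod x 0 m %[modX m.+1].
Proof.
move=> mn; rewrite /qprod (big_cat_nat (leq0n m) mn) /=.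
rewrite -[X in _ = X %[modX _]]mulr1; apply: eqmodX_mul => //.
rewrite big_nat; apply: (big_ind (fun p => p = 1 %[modX m.+1])) => //.
  by move=> p q -> ->; rewrite mulr1.
by move=> k /andP[mk _]; rewrite -mul_polyC; apply: eqmodX_addMXn.
Qed.

Lemma thetaS n : theta n.+1 = theta n + ((-1) ^+ n.+1 * 'X^(n.+1 ^ 2)) *+ 2.
Proof. by rewrite /theta big_nat_recr // mulrnDl addrA. Qed.

(* The error term in Shanks' finite form of Gauss's identity. *)
Definition shanks_sum n : {poly R} := \sum_(0 <= s < n)
  (-1) ^+ s * qprod 1 0 s * qprod (-1) s.+1 n * 'X^(s.+1 * n.+1).

Lemma shanks_sumS n : shanks_sum n.+1 =
  (1 + 'X^(n.+1)) * (shanks_sum n + (-1) ^+ n * qprod 1 0 n * 'X^(n.+1 ^ 2))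
  - qprod (-1) 0 n * 'X^(n.+1).
Proof.
pose f s : {poly R} :=
  (-1) ^+ s * qprod 1 0 s * qprod (-1) s n * 'X^(s.+1 * n.+1).
have f0 : f 0%N = qprod (-1) 0 n * 'X^(n.+1).
  by rewrite /f [qprod 1 _ _]qprod_geq // mul1n expr0 !mul1r.
have fn : f n = (-1) ^+ n * qprod 1 0 n * 'X^(n.+1 ^ 2).
  by rewrite /f [qprod (-1) _ _]qprod_geq // mulr1.
have telescope : \sum_(0 <= s < n)
    (-1) ^+ s * qprod 1 0 s * qprod (-1) s.+1 n.+1 * 'X^(s.+1 * n.+2) =
    (1 + 'X^(n.+1)) * shanks_sum n + (f n - f 0%N).
  rewrite -(telescope_sumr f) // mulr_sumr -big_split /=.
  apply: eq_big_nat => s /andP[_ sn].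
  rewrite /f qprod_recr // (qprod_recl _ sn) (qprod_recr 1) //.
  rewrite scale1r !scaleN1r.
  have -> : (s.+1 * n.+2 = s.+1 * n.+1 + s.+1)%N by lia.
  have -> : (s.+2 * n.+1 = s.+1 * n.+1 + n.+1)%N by lia.
  by rewrite !exprD (exprS (-1)); ring.
rewrite {1}/shanks_sum big_nat_recr //= telescope f0 fn.
rewrite [qprod (-1) n.+1 _]qprod_geq //.
have -> : (n.+1 * n.+2 = n.+1 ^ 2 + n.+1)%N by lia.
by rewrite exprD; ring.
Qed.

Lemma qprod_theta n :
  qprod 1 0 n * theta n = qprod (-1) 0 n - shanks_sum n *+ 2.
Proof.
elim: n => [|n IH].
  rewrite /theta /shanks_sum !qprod_geq // !big_geq //.
  by rewrite !mul0rn subr0 addr0 mulr1.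
rewrite shanks_sumS !qprod_recr // thetaS scale1r scaleN1r.
transitivity (qprod 1 0 n * theta n * (1 + 'X^(n.+1)) +
    (qprod 1 0 n * (1 + 'X^(n.+1)) * ((-1) ^+ n.+1 * 'X^(n.+1 ^ 2))) *+ 2).
  by ring.
by rewrite IH (exprS (-1)); ring.
Qed.

Lemma eqmodX_qprod_theta n :
  qprod 1 0 n * theta n = qprod (-1) 0 n %[modX n.+1].
Proof.
move=> i iN; rewrite qprod_theta coefB coefMn coef_sum big1 ?mul0rn ?subr0 //.
by move=> s _; rewrite coefMXn; case: ltnP => //; nia.
Qed.

Lemma coef0_theta n : (theta n)`_0 = 1.
Proof.
by have := @eqmodX_qprod_theta n 0 isT; rewrite coef0M !coef0_qprod mul1r.
Qed.

Lemma cnorm_qprod x n : x ^+ 3 = x ->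
  cnorm (qprod x 0 (3 * n)) * (qprod x 0 n \Po 'X^3) =
  qprod x 0 (3 * n) * qprod x 0 n ^+ 3.
Proof.
move=> x_cube; elim: n => [|n IH].
  by rewrite muln0 !qprod_geq // cnorm1 comp_polyC !mul1r expr1n.
have tripleS : (3 * n.+1 = (3 * n).+3)%N by lia.
rewrite {1 2}tripleS !qprod_recr // !cnormM comp_polyM comp_polyD comp_polyC.
rewrite comp_monomialXn -tripleS cnorm_binomialX3.
rewrite !cnorm_binomial ?x_cube; try lia.
set u := 1 + x *: 'X^(_.+1); set v := 1 + x *: 'X^(_.+2).
set z := 1 + x *: 'X^(3 * _); set y := 1 + _.
transitivity (cnorm (qprod x 0 (3 * n)) * (qprod x 0 n \Po 'X^3) *
    (u * v * y ^+ 3 * z)); first by ring.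
by rewrite IH; ring.
Qed.

Lemma eqmodX_cnorm_qprod x n : x ^+ 3 = x ->
  cnorm (qprod x 0 (3 * n)) * (qprod x 0 n \Po 'X^3) =
  qprod x 0 n ^+ 4 %[modX n.+1].
Proof.
by move=> x_cube; rewrite cnorm_qprod // (@eqmodX_qprod x n) ?exprS //; lia.
Qed.

Lemma eqmodX_cnorm_theta n :
  cnorm (theta (3 * n)) * (theta n \Po 'X^3) = theta n ^+ 4 %[modX n.+1].
Proof.
have gauss_cnorm : cnorm (qprod 1 0 (3 * n)) * cnorm (theta (3 * n)) =
    cnorm (qprod (-1) 0 (3 * n)) %[modX n.+1].
  rewrite -cnormM; apply: eqmodX_cnorm.
  by rewrite addn1; apply: eqmodX_qprod_theta.
have gauss_compX3 : (qprod 1 0 n \Po 'X^3) * (theta n \Po 'X^3) =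
    qprod (-1) 0 n \Po 'X^3 %[modX n.+1].
  rewrite -comp_polyM; apply: (@eqmodX_leq _ _ (3 * n.+1)); first by lia.
  by apply: eqmodX_comp_polyXn => //; apply: eqmodX_qprod_theta.
apply: (@eqmodX_lreg _ _ (qprod 1 0 n ^+ 4)).
  by rewrite coef0_exp coef0_qprod expr1n; apply: lreg1.
rewrite -exprMn eqmodX_qprod_theta.
rewrite -!eqmodX_cnorm_qprod ?expr1n //; last by ring.
by rewrite -gauss_cnorm -gauss_compX3 mulrACA.
Qed.

Lemma signed_square_trisect3 m :
  (-1) ^+ (3 * m) * 'X^((3 * m) ^ 2) =
  trisect (((-1) ^+ m * 'X^(m ^ 2)) \Po 'X^3) 0 0 :> {poly R}.
Proof.
rewrite -comp_polyX3_trisect !comp_signed_monomialXn.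
rewrite -[in LHS]signr_odd -[in RHS]signr_odd oddM /=.
by congr (_ * 'X^_); lia.
Qed.

Lemma signed_square_trisect m : ~~ (3 %| m)%N ->
  (-1) ^+ m * 'X^(m ^ 2) =
  trisect 0 ((-1) ^+ m * 'X^(m ^ 2 %/ 3)) 0 :> {poly R}.
Proof.
move=> m_ndvd3; have sqE : (m ^ 2 = (3 * (m ^ 2 %/ 3)).+1)%N.
  have [k [mE|mE]] : exists k, m = (3 * k + 1)%N \/ m = (3 * k + 2)%N.
  - by exists (m %/ 3)%N; lia.
  - by rewrite mE; nia.
  - by rewrite mE; nia.
rewrite /trisect !comp_poly0 comp_signed_monomialXn [in LHS]sqE exprSr.
by rewrite add0r mul0r addr0 mulrA.
Qed.

Lemma theta_trisect n :
  exists b, theta (3 * n) = trisect (theta n \Po 'X^3) b 0.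
Proof.
elim: n => [|n [b thetaE]].
  exists 0; rewrite -comp_polyX3_trisect /theta !big_geq //.
  by rewrite mul0rn addr0 !comp_polyC.
have tripleS : (3 * n.+1 = (3 * n).+3)%N by lia.
have ndvd1 : ~~ (3 %| (3 * n).+1)%N by lia.
have ndvd2 : ~~ (3 %| (3 * n).+2)%N by lia.
exists (b + ((-1) ^+ (3 * n).+1 * 'X^((3 * n).+1 ^ 2 %/ 3)) *+ 2
          + ((-1) ^+ (3 * n).+2 * 'X^((3 * n).+2 ^ 2 %/ 3)) *+ 2).
rewrite tripleS !thetaS -tripleS signed_square_trisect3.
rewrite (signed_square_trisect ndvd1) (signed_square_trisect ndvd2).
rewrite thetaE !mulr2n !comp_polyD !trisectD.
by congr trisect; ring.
Qed.

End Theta.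

Lemma sum_distance_to_center (V : nmodType) (f : nat -> V) (n : nat) :
  \sum_(x < 2 * n + 1) f `|x%:Z - n%:Z|%N =
  f 0%N + (\sum_(1 <= s < n.+1) f s) *+ 2.
Proof.
elim: n => [|n IH].
  by rewrite big_geq // mul0rn addr0 big_ord_recl big_ord0 addr0.
have -> : (2 * n.+1 + 1 = (2 * n + 1).+2)%N by lia.
rewrite big_ord_recl big_ord_recr [in RHS]big_nat_recr //= subn0 /bump add1n.
have -> : `|(2 * n + 1).+1%:Z - n.+1%:Z|%N = n.+1 by lia.
rewrite (eq_bigr (fun x : 'I_(2 * n + 1) => f `|x%:Z - n%:Z|%N)); last first.
  by move=> x _; congr (f _); lia.
by rewrite IH mulrnDl !mulr2n addrCA -!addrA.
Qed.

Lemma coef_theta_exp (R : comNzRingType) (k n : nat) :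
  (theta R n ^+ k)`_n = (-1) ^+ n * (r_sq k n)%:R.
Proof.
pose dist (x : 'I_(2 * n + 1)) := `|x%:Z - n%:Z|%N.
have -> : theta R n = \sum_x (-1) ^+ (dist x ^ 2) * 'X^(dist x ^ 2).
  rewrite (sum_distance_to_center (fun s => (-1) ^+ (s ^ 2) * 'X^(s ^ 2))).
  rewrite mul1r; congr (_ + _ *+ 2); apply: eq_bigr => s _; congr (_ * _).
  by rewrite -[LHS]signr_odd -[RHS]signr_odd oddX.
rewrite -[k in LHS]card_ord -prodr_const bigA_distr_bigA coef_sum.
rewrite /r_sq -sum1dep_card natr_sum mulr_sumr [RHS]big_mkcond /=.
apply: eq_bigr => x _; rewrite big_split /= !prodrXr.
have -> : \sum_(i < k) ((x i)%:Z - n%:Z) ^+ 2 =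
    (\sum_(i < k) dist (x i) ^ 2)%N%:Z.
  rewrite -[RHS]natz natr_sum; apply: eq_bigr => i _.
  by rewrite natz /dist; lia.
rewrite eqz_nat -(rmorph_sign (@polyC R)) coefCM coefXn eq_sym.
by case: eqP => [->|_]; rewrite ?mulr0.
Qed.

Section OverpartitionSeries.
Variable R : comNzRingType.
Implicit Type n : nat.

(* The weight [(0 < j).+1] counts the ways to overline a part occurring [j]
   times. *)
Definition overpart_poly n : {poly R} :=
  \prod_(i < n) \sum_(j < n.+1) 'X^(i.+1 * j) *+ (0 < j).+1.

Lemma card_overlinings n (m : {ffun 'I_n -> 'I_n.+1}) :
  #|[set o : {ffun 'I_n -> bool} | [forall i, o i ==> (0 < m i)%N]]| =
  (\prod_(i < n) (0 < m i).+1)%N.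
Proof.
transitivity (\prod_(i < n) #|[pred b : bool | b ==> (0 < m i)%N]|)%N.
  have := card_family (fun i => [pred b : bool | b ==> (0 < m i)%N]).
  rewrite foldrE big_image /= => <-; rewrite cardsE; apply: eq_card => o.
  by apply/forallP/familyP.
apply: eq_bigr => i _; rewrite -sum1_card big_mkcond big_bool /=.
by case: (0 < m i)%N.
Qed.

Lemma coef_overpart_poly n : (overpart_poly n)`_n = (overpartition_count n)%:R.
Proof.
rewrite /overpart_poly bigA_distr_bigA coef_sum.
rewrite /overpartition_count -sum1dep_card.
rewrite -(pair_big_dep xpredT (@is_overpartition n) (fun _ _ => 1%N)) natr_sum.
apply: eq_bigr => m _ /=; rewrite prodrMn prodrXr coefMn coefXn sum1dep_card.
rewrite /is_overpartition eq_sym; case: eqP => _ /=.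
  by rewrite card_overlinings.
by rewrite mul0rn (eq_card (B := pred0)) ?card0 // => o; rewrite inE.
Qed.

Lemma overline_geometric (x : {poly R}) n :
  (1 - x) * (\sum_(j < n.+1) x ^+ j *+ (0 < j).+1) = 1 + x - x ^+ n.+1 *+ 2.
Proof.
rewrite big_ord_recl expr0 /=.
have -> : \sum_(j < n) x ^+ bump 0 j *+ 2 = (x * \sum_(j < n) x ^+ j) *+ 2.
  by rewrite mulr_sumr -sumrMnl; apply: eq_bigr => j _; rewrite exprS.
have geometric := subrX1 x n.
transitivity (1 - x - (x * ((x - 1) * \sum_(j < n) x ^+ j)) *+ 2).
  by ring.
by rewrite -geometric exprS; ring.
Qed.

Lemma eqmodX_qprod_overpart n :
  qprod (-1) 0 n * overpart_poly n = qprod 1 0 n %[modX n.+1].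
Proof.
rewrite /qprod !big_mkord -big_split /=; apply: eqmodX_prod => k _.
rewrite scaleN1r scale1r; under eq_bigr => j _ do rewrite exprM.
rewrite overline_geometric -exprM -mulr_natl -mulNr.
by apply: eqmodX_addMXn; lia.
Qed.

Lemma eqmodX_overpart_theta n : overpart_poly n * theta R n = 1 %[modX n.+1].
Proof.
apply: (@eqmodX_lreg _ _ (qprod 1 0 n * qprod (-1) 0 n)).
  by rewrite coef0M !coef0_qprod mulr1; apply: lreg1.
have -> : qprod 1 0 n * qprod (-1) 0 n * (overpart_poly n * theta R n) =
    qprod (-1) 0 n * overpart_poly n * (qprod 1 0 n * theta R n) by ring.
by rewrite eqmodX_qprod_overpart eqmodX_qprod_theta mulr1.
Qed.

Lemma multisect_overpart n :
  multisect 3 0 (overpart_poly (3 * n)) * theta R n ^+ 4 =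
  (theta R n \Po 'X^3) ^+ 3 %[modX n.+1].
Proof.
have [b thetaE] := theta_trisect R n.
have overpart_inv := @eqmodX_overpart_theta (3 * n).
rewrite thetaE -addn1 in overpart_inv.
rewrite -eqmodX_cnorm_theta mulrA thetaE multisect_inverse_cnorm //.
by rewrite mulr0 subr0 -exprSr.
Qed.

End OverpartitionSeries.

Lemma exprDMn_expn2_eq0 (R : comNzRingType) (n : nat) (x y : R) :
  (n ^ 2)%:R = 0 :> R -> (x + y *+ n) ^+ n = x ^+ n.
Proof.
move=> n2_eq0; rewrite exprDn big_ord_recl subn0 expr0 mulr1 bin0 mulr1n.
rewrite big1 ?addr0 // => i _; rewrite exprMn_n mulrnAr -mulrnA.
suff /dvdnP[c ->] : (n ^ 2 %| n ^ bump 0 i * 'C(n, bump 0 i))%N.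
  by rewrite mulnC -mulr_natr natrM n2_eq0 mul0r mulr0.
case: i => [[|i] ip] /=; first by rewrite bin1 mulnn.
by rewrite dvdn_mulr // dvdn_exp2l.
Qed.

Lemma exprD_prime (R : comNzRingType) (p : nat) (x y : R) :
  prime p -> exists z, (x + y) ^+ p = x ^+ p + y ^+ p + z *+ p.
Proof.
case: p => // n p_prime.
exists (\sum_(i < n) (x ^+ (n - i) * y ^+ i.+1) *+ ('C(n.+1, i.+1) %/ n.+1)).
rewrite exprDn big_ord_recl big_ord_recr /= subn0 /bump add1n subnn.
rewrite !mulr1 mul1r binn -addrA [X in _ + X]addrC; congr (_ + (_ + _)).
rewrite -sumrMnl; apply: eq_bigr => i _.
by rewrite add1n subSS -mulrnA divnK // prime_dvd_bin // !ltnS ltn_ord.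
Qed.

Lemma comp_polyXp_prime (R : comNzRingType) (p : nat) : prime p ->
  (forall x : R, exists y, x ^+ p = x + y *+ p) ->
  forall q : {poly R}, exists r, q \Po 'X^p = q ^+ p + r *+ p.
Proof.
move=> p_prime fermat; elim/poly_ind => [|q x [r IH]].
  by exists 0; rewrite comp_poly0 expr0n gtn_eqF ?prime_gt0 // mul0rn addr0.
have [y xE] := fermat x; have [z qE] := exprD_prime (q * 'X) x%:P p_prime.
exists (r * 'X^p - y%:P - z).
rewrite comp_polyD comp_polyM comp_polyX comp_polyC IH qE exprMn -polyC_exp xE.
by rewrite polyCD polyCMn mulrDl mulrnAl !mulrnBl; ring.
Qed.

Lemma Zp_fermat (m p : nat) :
  prime p -> forall x : 'Z_m, exists y, x ^+ p = x + y *+ p.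
Proof.
move=> p_prime x; have le_x_xp : (x <= x ^ p)%N.
  case: (x : nat) => // k.
  by rewrite -[leqLHS]expn1 leq_pexp2l // prime_gt0.
have /dvdnP[c xpE] : (p %| x ^ p - x)%N.
  by rewrite -eqn_mod_dvd //; apply/eqP/fermat_little.
exists c%:R; rewrite -(natr_Zp x) -natrX -(subnKC le_x_xp) xpE.
by rewrite natrD natrM mulr_natr.
Qed.

Lemma comp_polyXp_expr (p : nat) (q : {poly 'Z_(p ^ 2)}) :
  prime p -> (q \Po 'X^p) ^+ p = q ^+ (p ^ 2).
Proof.
move=> p_prime.
have [r ->] := comp_polyXp_prime p_prime (@Zp_fermat _ _ p_prime) q.
rewrite exprDMn_expn2_eq0 -?exprM // -polyC_natr pchar_Zp //.
by rewrite -[1%N](exp1n 2) ltn_exp2r ?prime_gt1.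
Qed.

Lemma eqz_modZp (m : nat) (a b : int) : (1 < m)%N ->
  (a == b %[mod m])%Z = (a%:~R == b%:~R :> 'Z_m).
Proof.
move=> m_gt1; rewrite eqz_mod_dvd -[RHS]subr_eq0 -rmorphB /=.
have Zp_natr_eq0 k : (k%:R == 0 :> 'Z_m) = (m %| k)%N.
  by rewrite -val_eqE /= val_Zp_nat.
case: (a - b) => k; first by rewrite dvdzE -Zp_natr_eq0.
by rewrite NegzE rmorphN oppr_eq0 dvdzE abszN -Zp_natr_eq0.
Qed.

Theorem theorem5 (n : nat) (hn : (1 <= n)%N) :
  ((overpartition_count (3 * n))%:Z = (-1) ^+ n * (r_sq 5 n)%:Z %[mod 9])%Z.
Proof.
pose Z9 := 'Z_(3 ^ 2); pose t := theta Z9 n.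
have trisected_series :
    multisect 3 0 (overpart_poly Z9 (3 * n)) = t ^+ 5 %[modX n.+1].
  apply: (@eqmodX_lreg _ _ (t ^+ 4)).
    by rewrite coef0_exp coef0_theta expr1n; apply: lreg1.
  by rewrite mulrC multisect_overpart comp_polyXp_expr // -exprD.
have := trisected_series n (ltnSn n).
rewrite coef_multisect // addn0 coef_overpart_poly coef_theta_exp => coefE.
by apply/eqP; rewrite (@eqz_modZp (3 ^ 2)) // rmorphM rmorph_sign; apply/eqP.
Qed.
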